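(* Let $J>0$, $h\ne0$, $\rho>0$, and $\varepsilon\in\mathcal{E}_{h,\rho}$. Define $m=-\frac hJ+\mathrm{sgn}(h)\sqrt{\frac{h^2}{J^2}-\frac{2\varepsilon}J}$ and $\mu=-\frac m{\rho-m^2}$. Let $I\subset\Lambda$ be an index set of fixed size and $f:\mathbb{R}^{|I|}\to\mathbb{R}$ a bounded $1$-Lipschitz function with respect to $\|\cdot\|_2$. Then \[ \langle f\circ P_I\rangle_{\mathrm{MC}}^{\varepsilon,\rho;N}=\langle f\circ P_I\rangle_{\mathrm{C}}^{\mu,\rho;N}+O(N^{-1/2}). \]
   Context: Mean-field spherical model: $\Lambda$ finite lattice, $N=|\Lambda|$, $\phi\in\mathbb{R}^N$, $H[\phi]=-\frac J{2N}(\sum_x\phi_x)^2-h\sum_x\phi_x$; $P_I$ restricts to sites in $I$. For $|m|<\sqrt\rho$, $\mu_{\mathrm{MC}}^{m,\rho;N}$ is the normalized uniform surface measure on $\{\sum\phi_x=mN,\ \sum\phi_x^2=\rho N\}$ and $Z_{\mathrm{MC}}(m,\rho;N)=(\rho-m^2)^{(N-3)/2}$. For $\varepsilon\le\frac{h^2}{2J}$, $m_\pm=-\frac hJ\pm\sqrt{\frac{h^2}{J^2}-\frac{2\varepsilon}J}$. Fixed energy ensemble: if $\varepsilon<\frac{h^2}{2J}$ and $m_\pm^2<\rho$, $\langle f\rangle_{\mathrm{MC}}^{\varepsilon,\rho;N}=\sum_\pm\frac{Z_{\mathrm{MC}}(m_\pm,\rho;N)}{Z_{\mathrm{MC}}(m_+,\rho;N)+Z_{\mathrm{MC}}(m_-,\rho;N)}\langle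 f\rangle_{\mathrm{MC}}^{m_\pm,\rho;N}$; if $\varepsilon<\frac{h^2}{2J}$ and $\min(m_\pm^2)<\rho\le\max(m_\pm^2)$, it is $\langle f\rangle_{\mathrm{MC}}^{m',\rho;N}$ with $m'$ the one of $m_\pm$ of smaller absolute value; if $\varepsilon=\frac{h^2}{2J}$ and $\rho>h^2/J^2$, it is $\langle f\rangle_{\mathrm{MC}}^{-h/J,\rho;N}$. $\mathcal{E}_{h,\rho}=\{\varepsilon\le\frac{h^2}{2J}:|\frac{|h|}J-\sqrt{\frac{h^2}{J^2}-\frac{2\varepsilon}J}|<\sqrt\rho\}$. Auxiliary canonical ensemble: $\langle f\rangle_{\mathrm{C}}^{\mu,\rho;N}=\frac{\int_{-\sqrt\rho}^{\sqrt\rho}dm'\,e^{-\mu Nm'}(\rho-m'^2)^{(N-3)/2}\langle f\rangle_{\mathrm{MC}}^{m',\rho;N}}{\int_{-\sqrt\rho}^{\sqrt\rho}dm'\,e^{-\mu Nm'}(\rho-m'^2)^{(N-3)/2}}$. *)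

(* Defs.v *)
From HB Require Import structures.
From mathcomp Require Import all_boot all_order all_algebra.
From mathcomp Require Import all_classical all_reals all_analysis.
Set Implicit Arguments. Unset Strict Implicit. Unset Printing Implicit Defensive.
Import Order.TTheory GRing.Theory Num.Theory.
Import numFieldNormedType.Exports.
Local Open Scope classical_set_scope.
Local Open Scope ring_scope.

Section MeanFieldSpherical.
Variable R : realType.

Fixpoint iint (n : nat) (F : seq R -> R) : R :=
  match n with
  | 0%N => F [::]
  | n'.+1 => Rintegral (@lebesgue_measure R) setT
               (fun t : R => iint n' (fun s => F (t :: s)))
  end.

(* Linear bijection R^(N-1) -> H := {x in R^N | sum_x x = 0}. *)
Definition hyp_emb (N : nat) (y : seq R) : 'I_N -> R :=
  fun i => if (i < N.-1)%N then nth 0 y i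
           else - \sum_(j < N.-1) nth 0 y j.
Arguments hyp_emb : clear implicits.

Definition norm2 (N : nat) (x : 'I_N -> R) : R := Num.sqrt (\sum_i x i ^+ 2).

(* <g>_MC^{m,rho;N}: expectation of g under the normalized uniform surface
   measure on {sum phi = m N, sum phi^2 = rho N}, i.e. the sphere of radius
   sqrt(N (rho - m^2)) centered at m*1 in the affine hyperplane m*1 + H.
   The normalized surface measure on a sphere is written as the normalized
   cone measure: <g> = (1/lambda_H(B)) int_{B} g(center + r x/|x|) dlambda_H(x),
   B the unit ball of H, lambda_H a Haar (Lebesgue) measure on H, here
   realized as the push-forward of Lebesgue measure on R^(N-1) by hyp_emb
   (any normalization of lambda_H cancels in the ratio). *)
Definition MC_avg (m rho : R) (N : nat) (g : ('I_N -> R) -> R) : R :=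
  let r := Num.sqrt (N%:R * (rho - m ^+ 2)) in
  let ball := fun y : seq R => if norm2 (hyp_emb N y) <= 1 then 1 else 0 in
  iint N.-1 (fun y => ball y *
      g (fun i => m + r * (hyp_emb N y i / norm2 (hyp_emb N y))))
  / iint N.-1 ball.

Definition Z_MC (m rho : R) (N : nat) : R :=
  powR (rho - m ^+ 2) ((N%:R - 3) / 2).

Definition m_plus (J h eps : R) : R :=
  - (h / J) + Num.sqrt (h ^+ 2 / J ^+ 2 - 2 * eps / J).
Definition m_minus (J h eps : R) : R :=
  - (h / J) - Num.sqrt (h ^+ 2 / J ^+ 2 - 2 * eps / J).

(* Fixed energy ensemble <g>_MC^{eps,rho;N}; 0 outside the cases where it is
   defined in the paper. *)
Definition FE_avg (J h eps rho : R) (N : nat) (g : ('I_N -> R) -> R) : R :=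
  let mp := m_plus J h eps in
  let mm := m_minus J h eps in
  if (eps < h ^+ 2 / (2 * J)) && (mp ^+ 2 < rho) && (mm ^+ 2 < rho) then
    Z_MC mp rho N / (Z_MC mp rho N + Z_MC mm rho N) * MC_avg mp rho g
    + Z_MC mm rho N / (Z_MC mp rho N + Z_MC mm rho N) * MC_avg mm rho g
  else if (eps < h ^+ 2 / (2 * J)) && (Num.min (mp ^+ 2) (mm ^+ 2) < rho)
          && (rho <= Num.max (mp ^+ 2) (mm ^+ 2)) then
    MC_avg (if `|mp| <= `|mm| then mp else mm) rho g
  else if (eps == h ^+ 2 / (2 * J)) && (h ^+ 2 / J ^+ 2 < rho) then
    MC_avg (- (h / J)) rho g
  else 0.

Definition in_energy_set (J h rho eps : R) : Prop :=
  eps <= h ^+ 2 / (2 * J) /\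
  `| `|h| / J - Num.sqrt (h ^+ 2 / J ^+ 2 - 2 * eps / J) | < Num.sqrt rho.

Definition C_avg (mu rho : R) (N : nat) (g : ('I_N -> R) -> R) : R :=
  Rintegral (@lebesgue_measure R) `](- Num.sqrt rho), (Num.sqrt rho)[
    (fun m' => expR (- (mu * N%:R * m')) * Z_MC m' rho N * MC_avg m' rho g)
  / Rintegral (@lebesgue_measure R) `](- Num.sqrt rho), (Num.sqrt rho)[
    (fun m' => expR (- (mu * N%:R * m')) * Z_MC m' rho N).

(* P_I for I = image of an injective iota : 'I_k -> 'I_N. *)
Definition proj_I (k N : nat) (iota : 'I_k -> 'I_N) (phi : 'I_N -> R) : 'rV[R]_k :=
  \row_(j < k) phi (iota j).

Definition lipschitz1_2 (k : nat) (f : 'rV[R]_k -> R) : Prop :=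
  forall x y : 'rV[R]_k,
    `|f x - f y| <= Num.sqrt (\sum_(i < k) (x ord0 i - y ord0 i) ^+ 2).

End MeanFieldSpherical.

(* Main.v *)
Require Import Defs.
From HB Require Import structures.
From mathcomp Require Import all_boot all_order all_algebra all_fingroup.
From mathcomp Require Import all_classical all_reals all_analysis.
From mathcomp Require Import measurable_realfun measurable_fun_approximation.
From mathcomp Require Import ring lra zify.
Import Order.TTheory GRing.Theory Num.Theory.
Import numFieldNormedType.Exports.
Local Open Scope ring_scope.
Local Open Scope classical_set_scope.
Set Implicit Arguments. Unset Strict Implicit. Unset Printing Implicit Defensive.

(** Write A(x) for the microcanonical average at magnetization x and
    sigma(x) = sqrt (rho - x^2).
    - On the sphere of mean x the coordinates are x + sqrt N sigma(x) u_i with u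
      uniform on the unit sphere of the hyperplane, and <u_i^2> <= 1/N because
      all coordinates have the same law.  As f is 1-Lipschitz this gives
      |A(x) - A(m)| <= k (|x - m| + |sigma(x) - sigma(m)|) <= L |x - m|, with L
      independent of N.
    - The canonical weight w(x) = exp (- mu N x) sigma(x)^(N-3) concentrates at m.
      Integrating the derivative of (x - m) exp (- mu N x) sigma(x)^(N-1), which
      vanishes at +-sqrt rho, and using mu = - m / (rho - m^2), one gets
      N / (rho - m^2) E[(x - m)^2 (rho + m x)] = E[rho - m x];
      as rho + m x is bounded below, E (x - m)^2 = O(1/N) and E |x - m| is
      O(N^(-1/2)).  Hence the canonical average is A(m) + O(N^(-1/2)).
    - In the fixed energy ensemble the other magnetization has the larger
      absolute value, so its weight relative to m is exponentially small. *)

(** * Iterated integrals *)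

Lemma mkseq_cons T (f : nat -> T) n :
  mkseq f n.+1 = f 0%N :: mkseq (fun i => f i.+1) n.
Proof. by rewrite /mkseq /= (iotaDl 1 0) -map_comp. Qed.

Section IteratedIntegral.
Variable R : realType.
Local Notation mu := (@lebesgue_measure R).
Implicit Types F G : seq R -> R.

(* Joint measurability in the parameter and in [n] coordinates, tested on all
   measurable substitutions; this spares a sigma-algebra on lists. *)
Definition pmeasurable d (T : measurableType d) (n : nat) (G : T -> seq R -> R) :=
  forall d' (T' : measurableType d') (a : T' -> T) (x : nat -> T' -> R),
    measurable_fun setT a -> (forall i, measurable_fun setT (x i)) ->
    measurable_fun setT (fun t => G (a t) (mkseq (x^~ t) n)).

Lemma pmeasurable_cons d (T : measurableType d) n (G : T -> seq R -> R) :
  pmeasurable n.+1 G ->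
  pmeasurable n (fun (p : T * measurableTypeR R) s => G p.1 (p.2 :: s)).
Proof.
move=> mG d' T' a x ma mx.
pose x' i := if i is j.+1 then x j else fun t => (a t).2.
have mx' i : measurable_fun setT (x' i).
  by case: i => [|i]; [exact: measurableT_comp|exact: mx].
have := mG d' T' (fun t => (a t).1) x' (measurableT_comp measurable_fst ma) mx'.
by under eq_fun do rewrite mkseq_cons.
Qed.

(** The parameter space is arbitrary so that, in the induction, the outermost integration variable
    can join it. Positive and negative parts are integrated separately by Tonelli, which asks for
    measurability only. *)
Lemma measurable_iint d (T : measurableType d) n (G : T -> seq R -> R) :
  pmeasurable n G -> measurable_fun setT (fun t => iint n (G t)).
Proof.
elim: n d T G => [|n IH] d T G mG /=.
  have := mG _ T id (fun _ _ => 0) (@measurable_id _ _ _).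
  by apply; move=> i; exact: measurable_cst.
have /measurable_EFinP := IH _ _ _ (pmeasurable_cons mG).
set g := EFin \o _ => mg.
apply: measurableT_comp => //.
have mp : measurable_fun setT (fubini_F mu g^\+%E).
  by apply: measurable_fun_fubini_tonelli_F => //; exact: measurable_funepos.
have mn : measurable_fun setT (fubini_F mu g^\-%E).
  by apply: measurable_fun_fubini_tonelli_F => //; exact: measurable_funeneg.
rewrite [X in measurable_fun _ X](_ : _ = fubini_F mu g^\+%E \- fubini_F mu g^\-%E)%E.
  exact: emeasurable_funB.
apply/funext => t; rewrite integralE /fubini_F.
by congr (_ - _)%E; apply: eq_integral => x _; rewrite !(funeposE, funenegE).
Qed.

Lemma eq_iint n F G : (forall y, size y = n -> F y = G y) ->
  iint n F = iint n G.
Proof.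
elim: n F G => [|n IH] F G FG /=; first exact: FG.
by apply: eq_Rintegral => t _; apply: IH => y sy; apply: FG; rewrite /= sy.
Qed.

Definition measurable_seqfun n F := pmeasurable n (fun _ : unit => F).

Lemma measurable_seqfun_cons n F a : measurable_seqfun n.+1 F ->
  measurable_seqfun n (F \o cons a).
Proof.
move=> mF d' T' b x mb mx.
pose x' i := if i is j.+1 then x j else fun t => a.
have mx' i : measurable_fun setT (x' i).
  by case: i => [|i]; [exact: measurable_cst|exact: mx].
have := mF d' T' b x' mb mx'.
by under eq_fun do rewrite mkseq_cons.
Qed.

Lemma measurable_iint_cons n F : measurable_seqfun n.+1 F ->
  measurable_fun setT (fun t => iint n (F \o cons t)).
Proof.
move=> mF; have := @measurable_iint _ (measurableTypeR R) n (fun t s => F (t :: s)).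
apply.
move=> d' T' b x mb mx.
pose x' i := if i is j.+1 then x j else b.
have mx' i : measurable_fun setT (x' i) by case: i => [|i]; [exact: mb|exact: mx].
have := mF d' T' (fun=> tt) x' (measurable_cst _) mx'.
by under eq_fun do rewrite mkseq_cons.
Qed.

(** Domination by a multiple of the indicator of the cube [[-1, 1]^n]. This class is stable under
    fixing the first variable, so it gives integrability at every level of [iint]; all integrands
    over the unit ball belong to it. *)
Definition boxed n (M : R) F := measurable_seqfun n F /\
  forall y, size y = n -> `|F y| <= M * (all (fun t : R => `|t| <= 1) y)%:R.

Lemma boxed_cons n M F a : boxed n.+1 M F ->
  boxed n (M * (`|a| <= 1)%R%:R) (F \o cons a).
Proof.
move=> [mF bF]; split; first exact: measurable_seqfun_cons.
by move=> y sy; have := bF (a :: y); rewrite /= sy -mulrA -natrM mulnb; apply.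
Qed.

Lemma integrable_box (g : R -> R) (M : R) : measurable_fun setT g ->
  (forall t, `|g t| <= M * (`|t| <= 1)%R%:R) ->
  mu.-integrable setT (EFin \o g) /\ `|Rintegral mu setT g| <= 2 * M.
Proof.
move=> mg bg.
pose h : R -> R := fun t => M * \1_(`[-1, 1] : set R) t.
have hE t : h t = M * (`|t| <= 1)%R%:R.
  by rewrite /h indicE mem_setE in_itv/= ler_norml.
have ih : mu.-integrable setT (EFin \o h).
  have : mu.-integrable setT (fun t => M%:E * (\1_(`[-1, 1] : set R) t)%:E)%E.
    by apply: integrableZl => //; exact: integrable_indic_itv.
  by apply: eq_integrable.
have ig : mu.-integrable setT (EFin \o g).
  apply: (le_integrable _ _ _ ih) => //; first exact/measurable_EFinP.
  move=> t _ /=; rewrite lee_fin (le_trans (bg t))// -hE; exact: ler_norm.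
split => //.
apply: le_trans (le_normr_Rintegral _ ig) _ => //.
apply: (@le_trans _ _ (Rintegral mu setT h)).
  apply: le_Rintegral => //; last by move=> t _; have := bg t; rewrite -hE.
  exact: (integrable_norm ig).
rewrite RintegralZl//; last exact: integrable_indic_itv.
rewrite /Rintegral integral_indic//= setIT lebesgue_measure_itv/= lte_fin.
rewrite ifT; last by lra.
by rewrite /= opprK mulrC.
Qed.

Lemma boxed_iint_bound n M F : boxed n M F -> `|iint n F| <= 2 ^+ n * M.
Proof.
elim: n M F => [|n IH] M F bF.
  by rewrite /= mul1r; have := bF.2 [::] erefl; rewrite /= mulr1.
rewrite exprS -mulrA; apply: (integrable_box _ _).2.
  exact: (measurable_iint_cons bF.1).
by move=> t; rewrite -mulrA; exact: IH (boxed_cons t bF).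
Qed.

Lemma boxed_integrable n M F : boxed n.+1 M F ->
  mu.-integrable setT (EFin \o (fun t => iint n (F \o cons t))).
Proof.
move=> bF; apply: (integrable_box (M := 2 ^+ n * M) _ _).1.
  exact: (measurable_iint_cons bF.1).
by move=> t; rewrite -mulrA; exact: boxed_iint_bound (boxed_cons t bF).
Qed.

Lemma boxedD n M1 M2 F G : boxed n M1 F -> boxed n M2 G ->
  boxed n (M1 + M2) (fun y => F y + G y).
Proof.
move=> [mF bF] [mG bG]; split.
  by move=> d T a x ma mx; apply: measurable_funD;
    [exact: (mF d T a x)|exact: (mG d T a x)].
move=> y sy; rewrite mulrDl (le_trans (ler_normD _ _))// lerD//.
  exact: bF.
exact: bG.
Qed.

Lemma boxedZ n M F (c : R) : boxed n M F -> boxed n (`|c| * M) (fun y => c * F y).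
Proof.
move=> [mF bF]; split.
  move=> d T a x ma mx; apply: measurable_funM; first exact: measurable_cst.
  exact: (mF d T a x).
by move=> y sy; rewrite normrM -mulrA ler_wpM2l// bF.
Qed.

Lemma iintD n M1 M2 F G : boxed n M1 F -> boxed n M2 G ->
  iint n (fun y => F y + G y) = iint n F + iint n G.
Proof.
elim: n M1 M2 F G => [|n IH] M1 M2 F G bF bG //=.
rewrite -RintegralD//; [|exact: boxed_integrable bF|exact: boxed_integrable bG].
by apply: eq_Rintegral => t _; apply: IH; [exact: boxed_cons bF|exact: boxed_cons bG].
Qed.

Lemma iintZ n M F c : boxed n M F -> iint n (fun y => c * F y) = c * iint n F.
Proof.
elim: n M F => [|n IH] M F bF //=.
rewrite -RintegralZl//; last exact: boxed_integrable bF.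
by apply: eq_Rintegral => t _; apply: IH; exact: boxed_cons bF.
Qed.

Lemma iint_ge0 n F : (forall y, size y = n -> 0 <= F y) -> 0 <= iint n F.
Proof.
elim: n F => [|n IH] F F0 /=; first exact: F0.
by apply: Rintegral_ge0 => t _; apply: IH => y sy; apply: F0; rewrite /= sy.
Qed.

Lemma iintB n M1 M2 F G : boxed n M1 F -> boxed n M2 G ->
  iint n (fun y => F y - G y) = iint n F - iint n G.
Proof.
move=> bF bG; rewrite -(mulN1r (iint n G)) -(iintZ (-1) bG).
rewrite -(iintD bF (boxedZ (-1) bG)).
by apply: eq_iint => y _; rewrite mulN1r.
Qed.

Lemma le_iint n M1 M2 F G : boxed n M1 F -> boxed n M2 G ->
  (forall y, size y = n -> F y <= G y) -> iint n F <= iint n G.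
Proof.
move=> bF bG FG; rewrite -subr_ge0 -(iintB bG bF); apply: iint_ge0 => y sy.
by rewrite subr_ge0 FG.
Qed.

Lemma le_norm_iint n M1 M2 F G : boxed n M1 F -> boxed n M2 G ->
  (forall y, size y = n -> `|F y| <= G y) -> `|iint n F| <= iint n G.
Proof.
move=> bF bG FG; rewrite ler_norml -(mulN1r (iint n G)) -(iintZ (-1) bG).
apply/andP; split; [apply: (le_iint (boxedZ (-1) bG) bF) => y sy|
  apply: (le_iint bF bG) => y sy]; have := FG y sy;
  by rewrite ler_norml ?mulN1r => /andP[].
Qed.

End IteratedIntegral.

(** * Reflections and exchanges of variables that preserve the iterated integral *)

Section Symmetry.
Variable R : realType.
Local Notation mu := (@lebesgue_measure R).
Implicit Types F G : seq R -> R.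

Lemma measurable_reflect (c : R) :
  measurable_fun [set: measurableTypeR R] (fun t => - t - c : measurableTypeR R).
Proof. by apply: measurable_funB => //; exact: measurable_funN. Qed.

(** By uniqueness of Lebesgue measure it suffices to compare lengths of intervals []a, b]], whose
    preimages are [[- b - c, - a - c[]. *)
Lemma lebesgue_measure_reflect (c : R) (A : set R) : measurable A ->
  mu ((fun t => - t - c) @^-1` A) = mu A.
Proof.
move=> mA.
have mphi := measurable_reflect c.
pose nu := pushforward mu (fun t : R => - t - c).
pose nu' : {measure set (measurableTypeR R) -> \bar R} :=
  measure_function_pushforward__canonical__measure_function_Measure mu mphi.
rewrite -[LHS]/(nu' A) -(lebesgue_measure_unique (mu := nu'))//.
move=> X [[a b] _ <-].
transitivity (mu ((fun t : R => - t - c) @^-1` `]a, b])); last by [].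
have -> : (fun t : R => - t - c) @^-1` `]a, b]%classic = `[- b - c, - a - c[%classic.
  by apply/seteqP; split => t /=; rewrite !in_itv/= => /andP[? ?]; apply/andP; split; lra.
rewrite !lebesgue_measure_itv/= !lte_fin.
have -> : (- b - c < - a - c) = (a < b) by rewrite ltrD2r ltrN2.
by case: ifP => // _; rewrite -!EFinD; congr (_%:E); ring.
Qed.

Lemma Rintegral_reflect (c : R) (g : R -> R) :
  measurable_fun [set: R] g -> mu.-integrable setT (EFin \o g) ->
  Rintegral mu setT (fun t => g (- t - c)) = Rintegral mu setT g.
Proof.
move=> mg ig; rewrite /Rintegral; congr fine.
have mphi := measurable_reflect c.
(* The change of variables is applied to the reflected function. The map is an involution, so the
   composite whose integrability is required is [g] itself. *)
have E : (EFin \o g) = (fun t => (g (- (- t - c) - c))%:E).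
  by apply/funext => t /=; congr (g _)%:E; ring.
pose nu' : {measure set (measurableTypeR R) -> \bar R} :=
  measure_function_pushforward__canonical__measure_function_Measure mu mphi.
rewrite (eq_measure_integral nu'); last first.
  by move=> A mA _; exact/esym/lebesgue_measure_reflect.
rewrite (integral_pushforward mphi) //.
- by rewrite preimage_setT -E.
- by apply/measurable_EFinP; apply: measurableT_comp.
- by rewrite preimage_setT /comp -E.
Qed.

(** The last entry becomes [- c] minus the sum of all entries, [c] collecting the entries already
    passed. For [c = 0] this is the coordinate that [hyp_emb] eliminates, so the map exchanges the
    last two coordinates of the point in the hyperplane. *)
Fixpoint reflect_last (c : R) (y : seq R) : seq R :=
  if y is t :: s then
    if s is [::] then [:: - t - c] else t :: reflect_last (c + t) s
  else [::].

(** With the outer variables fixed, the innermost integration only sees an affine reflection of the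
    line. *)
Lemma iint_reflect_last n M F c : boxed n M F ->
  iint n (F \o reflect_last c) = iint n F.
Proof.
elim: n M F c => [|n IH] M F c bF //.
case: n IH bF => [_|n IH] bF /=.
  apply: (Rintegral_reflect c (g := fun t => F [:: t])).
    exact: (measurable_iint_cons bF.1).
  exact: (boxed_integrable bF).
apply: eq_Rintegral => t _.
transitivity (iint n.+1 ((F \o cons t) \o reflect_last (c + t))).
  have E y : size y = n.+1 ->
    (F \o reflect_last c) (t :: y) = ((F \o cons t) \o reflect_last (c + t)) y.
    by case: y.
  exact: (eq_iint E).
exact: IH (boxed_cons t bF).
Qed.

Fixpoint swap_at (i : nat) (y : seq R) : seq R :=
  match i, y with
  | 0, a :: b :: s => b :: a :: s
  | i'.+1, a :: s => a :: swap_at i' s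
  | _, _ => y
  end.

Lemma measurable_iint_cons2 n F : measurable_seqfun n.+2 F ->
  measurable_fun [set: measurableTypeR R * measurableTypeR R]
    (fun p => iint n (F \o cons p.1 \o cons p.2)).
Proof.
move=> mF; apply: (@measurable_iint _ _ _ n (fun p s => F (p.1 :: p.2 :: s))).
apply: (pmeasurable_cons (G := fun a s => F (a :: s))).
move=> d' T' a x ma mx.
pose x' i := if i is j.+1 then x j else a.
have mx' i : measurable_fun setT (x' i) by case: i => [|i]; [exact: ma|exact: mx].
have := mF d' T' (fun=> tt) x' (measurable_cst _) mx'.
by under eq_fun do rewrite mkseq_cons.
Qed.

(** Fubini in the two outermost variables, the remaining ones being integrated inside. *)
Lemma iint_swap_head n M F : boxed n.+2 M F ->
  iint n.+2 (F \o swap_at 0) = iint n.+2 F.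
Proof.
move=> bF.
pose g (p : measurableTypeR R * measurableTypeR R) : \bar R :=
  (iint n (F \o cons p.1 \o cons p.2))%:E.
have ig : (mu \x mu)%E.-integrable setT g.
  (* Joint integrability: the inner integral is at most [2 ^+ n * M] on this square and vanishes
     outside it. *)
  pose B : set (measurableTypeR R * measurableTypeR R) := `[-1, 1] `*` `[-1, 1].
  have mB : measurable B by exact: measurableX.
  have iB : (mu \x mu)%E.-integrable setT
      (fun p => (2 ^+ n * M)%:E * (\1_B p)%:E)%E.
    apply: integrableZl => //; apply/integrableP; split.
      by apply/measurable_EFinP; exact: measurable_indic.
    rewrite (eq_integral (fun x => (\1_B x)%:E)); last first.
      by move=> t _; rewrite gee0_abs// lee_fin.
    rewrite integral_indic// setIT.
    rewrite [ltLHS](product_measure1E mu mu)//.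
    rewrite [X in (X * X)%E]lebesgue_measure_itv/= lte_fin.
    by case: ifP => _; rewrite ?mul0e // -EFinD -EFinM ltry.
  apply: (le_integrable _ _ _ iB) => //.
    by apply/measurable_EFinP; exact: (measurable_iint_cons2 bF.1).
  move=> [a b] _; rewrite /g /= lee_fin.
  have := boxed_iint_bound (boxed_cons b (boxed_cons a bF)).
  move=> /le_trans; apply; apply: le_trans (ler_norm _).
  rewrite indicE /B in_setX/= !mem_setE !in_itv/= -!ler_norml.
  by rewrite -!mulrA -natrM mulnb.
(* Nested real integrals agree with nested extended ones, the form in which Fubini applies, because
   the inner integrals are finite. *)
have R2 (h : R -> R -> R) :
    (forall a, mu.-integrable setT (EFin \o h a)) ->
    Rintegral mu setT (fun a => Rintegral mu setT (h a)) =
    fine (\int[mu]_a \int[mu]_b (h a b)%:E)%E.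
  move=> ih; congr fine; apply: eq_integral => a _ /=.
  by rewrite /Rintegral fineK//; exact: integrable_fin_num (ih a).
have H1 a : mu.-integrable setT (EFin \o (fun b => iint n (F \o cons a \o cons b))).
  exact: boxed_integrable (boxed_cons a bF).
have mg : measurable_fun [set: measurableTypeR R * measurableTypeR R]
    (fun p => iint n (F \o cons p.1 \o cons p.2)) := measurable_iint_cons2 bF.1.
have H2 b : mu.-integrable setT (EFin \o (fun a => iint n (F \o cons a \o cons b))).
  apply: (integrable_box (M := 2 ^+ n * M) _ _).1.
    apply: (measurableT_comp (f := fun p : measurableTypeR R * measurableTypeR R =>
      iint n (F \o cons p.1 \o cons p.2)) mg (g := fun a => (a, b))).
    exact: measurable_fun_pair.
  move=> a; apply: le_trans (boxed_iint_bound (boxed_cons b (boxed_cons a bF))) _.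
  rewrite -!mulrA ler_wpM2l ?exprn_ge0// ler_wpM2l//; last first.
    by rewrite ler_piMr// lern1 leq_b1.
  (* The bound on the full integral forces [0 <= M]. *)
  have := boxed_iint_bound bF; move/(le_trans (normr_ge0 _)).
  by rewrite pmulr_rge0// exprn_gt0.
transitivity (Rintegral mu setT (fun b =>
    Rintegral mu setT (fun a => iint n (F \o cons a \o cons b)))); first by [].
rewrite R2//; transitivity (fine (\int[mu]_a \int[mu]_b g (a, b))%E).
  by congr fine; exact/esym/(Fubini ig).
exact/esym/(R2 _ H1).
Qed.

Lemma iint_swap_at n M F i : (i.+1 < n)%N -> boxed n M F ->
  iint n (F \o swap_at i) = iint n F.
Proof.
elim: i n M F => [|i IH] [|n] M F //.
  by case: n => // n _; exact: iint_swap_head.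
move=> lin bF /=; apply: eq_Rintegral => t _.
exact: IH (boxed_cons t bF).
Qed.

End Symmetry.

(** * Microcanonical averages *)

Section SphereCoordinates.
Variable R : realType.
Implicit Types y z : seq R.
Local Notation hyp_emb N := (@Defs.hyp_emb R N).

Lemma sum_swap_at i y : \sum_(t <- swap_at i y) t = \sum_(t <- y) t.
Proof.
elim: i y => [|i IH] [|a s] //=; last by rewrite !big_cons IH.
by case: s => // b s; rewrite !big_cons addrCA.
Qed.

Lemma size_swap_at i y : size (swap_at i y) = size y.
Proof.
elim: i y => [|i IH] [|a s] //=; last by rewrite IH.
by case: s.
Qed.

Lemma size_reflect_last c y : size (reflect_last c y) = size y.
Proof. by elim: y c => [|a [|b s] IH] c //=; rewrite IH. Qed.

Lemma rcons_swap_at i y b : (i.+1 < size y)%N ->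
  rcons (swap_at i y) b = swap_at i (rcons y b).
Proof.
elim: i y => [|i IH] [|a s] //=; first by case: s.
by move=> lis; rewrite IH.
Qed.

Lemma rcons_reflect_last c y : (0 < size y)%N ->
  rcons (reflect_last c y) (- c - \sum_(t <- reflect_last c y) t) =
  swap_at (size y).-1 (rcons y (- c - \sum_(t <- y) t)).
Proof.
elim: y c => [|a [|b s] IH] c // _.
  by rewrite /= !big_seq1; congr [:: _; _]; ring.
rewrite (_ : reflect_last c _ = a :: reflect_last (c + a) (b :: s))//.
move: (IH (c + a) isT); set r := reflect_last _ _; set z := b :: s => IHs.
by rewrite !(big_cons _ _ a)/= !(opprD a) !(addrA (- c)) -opprD IHs.
Qed.

Lemma nth_swap_at i z j : (i.+1 < size z)%N ->
  nth 0 (swap_at i z) j =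
  nth 0 z (if j == i then i.+1 else if j == i.+1 then i else j).
Proof.
elim: i z j => [|i IH] [|a s] j //=; first by case: s => // b s _; case: j => [|[|j]].
move=> lis; case: j => [|j] //=; rewrite IH// !eqSS.
by case: (j == i) => //; case: (j == i.+1).
Qed.

(** All coordinates of the hyperplane point as one list, on which both [swap_at] and [reflect_last]
    act as adjacent transpositions. *)
Definition hyp_seq y := rcons y (- \sum_(t <- y) t).

Lemma hyp_embE n y (i : 'I_n.+1) : size y = n ->
  hyp_emb n.+1 y i = nth 0 (hyp_seq y) i.
Proof.
move=> sy; rewrite /Defs.hyp_emb /hyp_seq nth_rcons sy /=; case: ltnP => // ni.
have -> : nat_of_ord i = n by apply/eqP; rewrite eqn_leq ni -ltnS ltn_ord.
by rewrite eqxx -sy (big_nth 0) big_mkord.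
Qed.

Lemma hyp_emb_swap_at n y (a b : 'I_n.+1) j : size y = n -> b = a.+1 :> nat ->
  (b < n)%N -> hyp_emb n.+1 (swap_at a y) j = hyp_emb n.+1 y (tperm a b j).
Proof.
move=> sy ba bn; rewrite !hyp_embE ?size_swap_at// /hyp_seq sum_swap_at.
rewrite rcons_swap_at ?sy -?ba// nth_swap_at; last by rewrite size_rcons sy -ba ltnW.
congr nth; rewrite -ba; case: tpermP => [->|->|ja jb].
- by rewrite eqxx.
- by rewrite eqxx ba -[_ == _]/(a.+1 == a)%N eqn_leq ltnn.
- by case: eqP => [/val_inj|_]//; case: eqP => [/val_inj|_].
Qed.

Lemma hyp_emb_reflect n y (a b : 'I_n.+1) j : size y = n -> b = a.+1 :> nat ->
  b = n :> nat -> hyp_emb n.+1 (reflect_last 0 y) j = hyp_emb n.+1 y (tperm a b j).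
Proof.
move=> sy ba bn; rewrite !hyp_embE ?size_reflect_last// /hyp_seq.
have y0 : (0 < size y)%N by rewrite sy; lia.
have := rcons_reflect_last 0 y0; rewrite !oppr0 !add0r => ->.
have -> : (size y).-1 = a by rewrite sy; lia.
rewrite nth_swap_at; last by rewrite size_rcons sy -ba bn.
congr nth; rewrite -ba; case: tpermP => [->|->|ja jb].
- by rewrite eqxx.
- by rewrite eqxx ba -[_ == _]/(a.+1 == a)%N eqn_leq ltnn.
- by case: eqP => [/val_inj|_]//; case: eqP => [/val_inj|_].
Qed.

Lemma norm2_perm N (x : 'I_N -> R) (s : {perm 'I_N}) : norm2 (x \o s) = norm2 x.
Proof. by rewrite /norm2 [in RHS](reindex_inj (@perm_inj _ s)). Qed.

Lemma norm2_ge0 N (x : 'I_N -> R) : 0 <= norm2 x.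
Proof. exact: sqrtr_ge0. Qed.

Lemma sqr_norm2 N (x : 'I_N -> R) : norm2 x ^+ 2 = \sum_i x i ^+ 2.
Proof. by rewrite sqr_sqrtr// sumr_ge0// => i _; exact: sqr_ge0. Qed.

Definition unit_ball (N : nat) (y : seq R) : R :=
  if norm2 (hyp_emb N y) <= 1 then 1 else 0.

Definition direction (N : nat) (y : seq R) (i : 'I_N) : R :=
  hyp_emb N y i / norm2 (hyp_emb N y).
Arguments direction : clear implicits.

(** The sum is 1 except at the zero vector, where division by zero makes it 0. *)
Lemma sum_direction_sqr_le1 N y : \sum_i direction N y i ^+ 2 <= 1.
Proof.
under eq_bigr do rewrite expr_div_n.
rewrite -mulr_suml -sqr_norm2.
by have [->|x0] := eqVneq (norm2 (hyp_emb N y) ^+ 2) 0; rewrite ?mul0r// divff.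
Qed.

Lemma unit_ball_ge0 N y : 0 <= unit_ball N y.
Proof. by rewrite /unit_ball; case: ifP. Qed.

Lemma unit_ball_le_box n y : size y = n ->
  unit_ball n.+1 y <= (all (fun t : R => `|t| <= 1) y)%:R.
Proof.
move=> sy; rewrite /unit_ball; case: ifPn => [y1|_]; last by rewrite ler0n.
rewrite (_ : all _ _)//; apply/(all_nthP 0) => i; rewrite sy => lin.
pose j : 'I_n.+1 := Ordinal (ltnW lin : i < n.+1)%N.
have yj : nth 0 y i = hyp_emb n.+1 y j.
  by rewrite hyp_embE// /hyp_seq nth_rcons sy lin.
rewrite -(@ler_pXn2r _ 2)// ?nnegrE// expr1n real_normK ?num_real// yj.
apply: (@le_trans _ _ (norm2 (hyp_emb n.+1 y) ^+ 2)).
  rewrite sqr_norm2 (bigD1 j)//= lerDl sumr_ge0// => l _; exact: sqr_ge0.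
by rewrite expr_le1// norm2_ge0.
Qed.

Lemma sqrt_sum_sqr_le k (u : 'I_k -> R) :
  Num.sqrt (\sum_i u i ^+ 2) <= \sum_i `|u i|.
Proof.
rewrite -(@ler_pXn2r _ 2)// ?nnegrE ?sqrtr_ge0 ?sumr_ge0// sqr_sqrtr; last first.
  by apply: sumr_ge0 => i _; exact: sqr_ge0.
suff [] : \sum_i u i ^+ 2 <= (\sum_i `|u i|) ^+ 2 /\ 0 <= \sum_i `|u i| by [].
elim/big_rec2: _ => [|i a b _ [ab a0]]; first by rewrite expr0n.
split; last by rewrite addr_ge0.
rewrite sqrrD real_normK ?num_real// -addrA lerD2l (le_trans ab)// lerDr.
by rewrite mulrn_wge0// mulr_ge0.
Qed.

(** * Measurability of the integrands on the sphere *)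

Section measurability.
Context d (T : measurableType d).

(** On nonnegative numbers, 0 included, the inverse is the measurable function [powR _ (-1)]. *)
Lemma measurable_invr_nonneg (x : T -> R) : measurable_fun setT x ->
  (forall t, 0 <= x t) -> measurable_fun setT (fun t => (x t)^-1).
Proof.
move=> mx x0.
under eq_fun => t do rewrite -(powR_inv1 (x0 t)).
exact: (measurableT_comp (@measurable_powR R (-1)) mx).
Qed.

Lemma measurable_sqrt (x : T -> R) : measurable_fun setT x ->
  measurable_fun setT (fun t => Num.sqrt (x t)).
Proof.
move=> mx; apply: (measurableT_comp _ mx).
by apply: continuous_measurable_fun; exact: sqrt_continuous.
Qed.

Lemma measurable_hyp_emb N (x : nat -> T -> R) (i : 'I_N) :
  (forall i, measurable_fun setT (x i)) ->
  measurable_fun setT (fun t => hyp_emb N (mkseq (x^~ t) N.-1) i).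
Proof.
move=> mx; rewrite /Defs.hyp_emb; have [iN|iN] := boolP (i < N.-1)%N.
  rewrite [X in measurable_fun _ X](_ : _ = x i) //.
  by apply/funext => t; rewrite nth_mkseq.
apply: measurable_funN; apply: measurable_sum => j.
rewrite [X in measurable_fun _ X](_ : _ = x j) //.
by apply/funext => t; rewrite nth_mkseq.
Qed.

Lemma measurable_norm2_hyp_emb N (x : nat -> T -> R) :
  (forall i, measurable_fun setT (x i)) ->
  measurable_fun setT (fun t => norm2 (hyp_emb N (mkseq (x^~ t) N.-1))).
Proof.
move=> mx; apply: measurable_sqrt; apply: measurable_sum => j.
by apply: measurable_funX; exact: measurable_hyp_emb.
Qed.

Lemma measurable_direction N (x : nat -> T -> R) (i : 'I_N) :
  (forall i, measurable_fun setT (x i)) ->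
  measurable_fun setT (fun t => direction N (mkseq (x^~ t) N.-1) i).
Proof.
move=> mx; apply: measurable_funM; first exact: measurable_hyp_emb.
apply: measurable_invr_nonneg => [|t]; last exact: norm2_ge0.
exact: measurable_norm2_hyp_emb.
Qed.

Lemma measurable_unit_ball N (x : nat -> T -> R) :
  (forall i, measurable_fun setT (x i)) ->
  measurable_fun setT (fun t => unit_ball N (mkseq (x^~ t) N.-1)).
Proof.
move=> mx; apply: measurable_fun_ifT => //.
by apply: measurable_fun_ler => //; exact: measurable_norm2_hyp_emb.
Qed.

(** Since [f] is 1-Lipschitz, [f X < a] holds exactly when some rational point [q] has
    [f q + dist q X < a]. A sublevel set is therefore a countable union of measurable sets. *)
Lemma measurable_lipschitz_comp k (f : 'rV[R]_k -> R) (x : 'I_k -> T -> R) :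
  lipschitz1_2 f -> (forall j, measurable_fun setT (x j)) ->
  measurable_fun setT (fun t => f (\row_j x j t)).
Proof.
move=> lf mx; apply: (measurability _ (RGenInftyO.measurableE R)).
move=> /= _ [_ [a ->]] <-; apply: measurableI => //.
pose dist (q : 'rV[rat]_k) t := Num.sqrt (\sum_j (x j t - ratr (q ord0 j)) ^+ 2).
have -> : (fun t => f (\row_j x j t)) @^-1` `]-oo, a[ =
    \bigcup_(q : 'rV[rat]_k) [set t | f (\row_j ratr (q ord0 j)) + dist q t < a].
  apply/seteqP; split=> [t /=|t [q _] /=]; rewrite in_itv/=; last first.
    apply: le_lt_trans; rewrite addrC -lerBlDr.
    apply: le_trans (ler_norm _) _; apply: le_trans (lf _ _) _.
    by rewrite /dist; under eq_bigr do rewrite !mxE.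
  set X := \row_j _ => fa.
  (* The [k] coordinate errors add up to less than half of the gap [a - f X]; one half pays for the
     distance, the other for the Lipschitz error of [f]. *)
  pose e := (a - f X) / 2 / k.+1%:R.
  have e0 : 0 < e by rewrite !divr_gt0// subr_gt0.
  have qx j : exists q : rat, `|x j t - ratr q| < e.
    have /rat_in_itvoo[q] : x j t - e < x j t + e by lra.
    by rewrite in_itv/= -ltr_distlC distrC => ?; exists q; rewrite distrC.
  have [q qP] := choice qx.
  exists (\row_j q j) => //=.
  have D : dist (\row_j q j) t < (a - f X) / 2.
    apply: (@le_lt_trans _ _ (\sum_(j < k) e)).
      apply: le_trans (sqrt_sum_sqr_le _) _; apply: ler_sum => j _.
      by rewrite mxE ltW.
    rewrite sumr_const card_ord -(mulr_natr e) /e mulrAC ltr_pdivrMr//.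
    by rewrite ltr_pM2l ?ltr_nat// divr_gt0 ?subr_gt0.
  have : `|f (\row_j ratr ((\row_j q j) ord0 j)) - f X| <= dist (\row_j q j) t.
    rewrite distrC; apply: le_trans (lf _ _) _.
    rewrite /dist; rewrite le_eqVlt; apply/orP; left; apply/eqP; congr Num.sqrt.
    by apply: eq_bigr => j _; rewrite !mxE.
  rewrite ler_norml; lra.
apply: countable_bigcupT_measurable => // q.
have mq : measurable_fun setT (fun t => f (\row_j ratr (q ord0 j)) + dist q t).
  apply: measurable_funD => //; apply: measurable_sqrt; apply: measurable_sum => j.
  by apply: measurable_funX; exact: measurable_funB.
have := mq measurableT `]-oo, a[ (measurable_itv _).
rewrite setTI; congr measurable; apply/seteqP; split => t /=; rewrite in_itv//=.
Qed.
End measurability.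

Lemma unit_ball_seqfun n : measurable_seqfun n (unit_ball n.+1).
Proof. by move=> d T a x _ mx; exact: (@measurable_unit_ball _ T n.+1). Qed.

Lemma boxed_unit_ball_mul n (c : R) (G : seq R -> R) : 0 <= c ->
  measurable_seqfun n (fun y => unit_ball n.+1 y * G y) ->
  (forall y, `|G y| <= c) -> boxed n c (fun y => unit_ball n.+1 y * G y).
Proof.
move=> c0 mG Gc; split => // y sy; rewrite normrM mulrC (ger0_norm (unit_ball_ge0 _ _)).
by apply: ler_pM (Gc y) (unit_ball_le_box sy) => //; exact: unit_ball_ge0.
Qed.

Lemma boxed_unit_ball n : boxed n 1 (unit_ball n.+1).
Proof.
split=> [|y sy]; first exact: unit_ball_seqfun.
by rewrite mul1r ger0_norm ?unit_ball_ge0// unit_ball_le_box.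
Qed.

(** * Second moments of the coordinates of a uniform direction *)

Definition direction_sqr (n : nat) (i : 'I_n.+1) (y : seq R) :=
  unit_ball n.+1 y * direction n.+1 y i ^+ 2.

Lemma boxed_direction_sqr n (i : 'I_n.+1) : boxed n 1 (direction_sqr i).
Proof.
apply: boxed_unit_ball_mul => //.
  move=> d T a x _ mx; apply: measurable_funM.
    exact: (@measurable_unit_ball _ T n.+1).
  by apply: measurable_funX; exact: (@measurable_direction _ T n.+1).
move=> y; rewrite ger0_norm ?sqr_ge0//.
apply: le_trans (sum_direction_sqr_le1 n.+1 y).
by rewrite (bigD1 i)//= lerDl sumr_ge0// => j _; exact: sqr_ge0.
Qed.

Lemma direction_sqr_perm n (s : {perm 'I_n.+1}) (g : seq R -> seq R) i y :
  (forall j, hyp_emb n.+1 (g y) j = hyp_emb n.+1 y (s j)) ->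
  direction_sqr i (g y) = direction_sqr (s i) y.
Proof.
move=> gs; have nE : norm2 (hyp_emb n.+1 (g y)) = norm2 (hyp_emb n.+1 y).
  by rewrite -[RHS](norm2_perm _ s); congr norm2; apply/funext => j; exact: gs.
by rewrite /direction_sqr /unit_ball /direction nE gs.
Qed.

(** A measure-preserving map exchanges the two coordinates: [reflect_last] if [b] is the eliminated
    coordinate, [swap_at] otherwise. *)
Lemma iint_direction_sqr_step n (a b : 'I_n.+1) : b = a.+1 :> nat ->
  iint n (direction_sqr a) = iint n (direction_sqr b).
Proof.
move=> ba; have bn : (b <= n)%N by rewrite -ltnS.
have := bn; rewrite leq_eqVlt => /orP[/eqP bn'|bn'].
  rewrite -(iint_reflect_last 0 (boxed_direction_sqr a)); apply: eq_iint => y sy.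
  rewrite /= (@direction_sqr_perm _ (tperm a b)) ?tpermL// => j.
  exact: hyp_emb_reflect.
rewrite -(iint_swap_at (i := a) _ (boxed_direction_sqr a)); last by rewrite -ba.
apply: eq_iint => y sy.
rewrite /= (@direction_sqr_perm _ (tperm a b)) ?tpermL// => j.
exact: hyp_emb_swap_at.
Qed.

Lemma iint_direction_sqr_eq n (i : 'I_n.+1) :
  iint n (direction_sqr i) = iint n (@direction_sqr n ord0).
Proof.
case: i => i; elim: i => [|i IH] lin.
  by rewrite (_ : Ordinal lin = ord0)//; exact: val_inj.
by rewrite -(IH (ltnW lin)); apply/esym/iint_direction_sqr_step.
Qed.

Lemma boxed_sum (I : Type) (r : seq I) n (G : I -> seq R -> R) M :
  (forall i, boxed n M (G i)) ->
  boxed n (\sum_(i <- r) M) (fun y => \sum_(i <- r) G i y) /\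
  iint n (fun y => \sum_(i <- r) G i y) = \sum_(i <- r) iint n (G i).
Proof.
move=> bG; elim: r => [|i r [IH1 IH2]].
  have b0 : boxed n 0 (fun=> 0 : R).
    split=> [d T a x _ mx|y _]; first exact: measurable_cst.
    by rewrite normr0 mul0r.
  rewrite !big_nil (_ : (fun _ => _) = (fun=> 0)); last first.
    by apply/funext => y; rewrite big_nil.
  by split => //; rewrite -[RHS](mul0r (iint n (fun=> 0))) -(iintZ 0 b0) mul0r.
have E : (fun y => \sum_(j <- i :: r) G j y) =
    (fun y => G i y + \sum_(j <- r) G j y).
  by apply/funext => y; rewrite big_cons.
split.
  by rewrite big_cons E; exact: boxedD.
by rewrite big_cons -IH2 -(iintD (bG i) IH1) E.
Qed.

(** The [n.+1] integrals are equal, and their sum is at most the volume of the ball. *)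
Lemma iint_direction_sqr_le n (i : 'I_n.+1) :
  iint n (direction_sqr i) <= iint n (unit_ball n.+1) / n.+1%:R.
Proof.
rewrite ler_pdivlMr// mulr_natr -[X in _ *+ X](card_ord n.+1) -sumr_const.
under eq_bigr => j _ do rewrite iint_direction_sqr_eq -(iint_direction_sqr_eq j).
have [b <-] := boxed_sum (index_enum 'I_n.+1) (@boxed_direction_sqr n).
apply: (le_iint b (boxed_unit_ball n)) => y sy.
rewrite -mulr_sumr ler_piMr ?unit_ball_ge0//; exact: sum_direction_sqr_le1.
Qed.

End SphereCoordinates.

(** * Dependence of the microcanonical average on the magnetization *)

Section MicrocanonicalAverage.
Variables (R : realType) (k : nat) (f : 'rV[R]_k -> R) (B : R).
Hypotheses (lf : lipschitz1_2 f) (fB : forall x, `|f x| <= B).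
Variables (rho : R) (n : nat) (iota : 'I_k -> 'I_n.+1).

Let obs (phi : 'I_n.+1 -> R) := f (proj_I iota phi).
Let A (m : R) := MC_avg m rho obs.
Let V := iint n (@unit_ball R n.+1).
Let radius (m : R) := Num.sqrt (n.+1%:R * (rho - m ^+ 2)).
Let sample (m : R) (y : seq R) : 'rV[R]_k :=
  \row_j (m + radius m * direction y (iota j)).

Let V_ge0 : 0 <= V.
Proof. by apply: iint_ge0 => y _; exact: unit_ball_ge0. Qed.

Let B_ge0 : 0 <= B.
Proof. exact: le_trans (normr_ge0 _) (fB 0). Qed.

Let measurable_sample d (T : measurableType d) (m : T -> R) (x : nat -> T -> R) :
  measurable_fun setT m -> (forall i, measurable_fun setT (x i)) ->
  measurable_fun setT (fun t => f (sample (m t) (mkseq (x^~ t) n))).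
Proof.
move=> mm mx; apply: (measurable_lipschitz_comp (x := fun j t =>
  m t + radius (m t) * direction (mkseq (x^~ t) n) (iota j)) lf) => j.
apply: measurable_funD => //; apply: measurable_funM.
  apply: measurable_sqrt; apply: measurable_funM => //.
  by apply: measurable_funB => //; exact: measurable_funX.
exact: (@measurable_direction R _ T n.+1).
Qed.

Let boxed_sample m :
  boxed n B (fun y => unit_ball n.+1 y * f (sample m y)).
Proof.
apply: boxed_unit_ball_mul => // d T a x _ mx.
apply: measurable_funM; first exact: (@measurable_unit_ball R _ T n.+1).
exact: (measurable_sample (measurable_cst m) mx).
Qed.

Let AE m : A m = iint n (fun y => unit_ball n.+1 y * f (sample m y)) / V.
Proof. by []. Qed.

Lemma measurable_MC_avg : measurable_fun setT A.
Proof.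
have -> : A = fun m => iint n (fun y => unit_ball n.+1 y * f (sample m y)) / V.
  by apply/funext => m; exact: AE.
apply: measurable_funM => //.
apply: (@measurable_iint _ _ (measurableTypeR R) n
  (fun m y => unit_ball n.+1 y * f (sample m y))) => d T a x ma mx.
apply: measurable_funM; first exact: (@measurable_unit_ball R _ T n.+1).
exact: (measurable_sample ma mx).
Qed.

(** For [V = 0] the quotient is 0 by convention, so the bound covers that case too. *)
Let ratio_le (a c : R) : 0 <= c -> `|a| <= c * V -> `|a / V| <= c.
Proof.
move=> c0; have [->|V0] := eqVneq V 0; first by rewrite invr0 !mulr0 normr0.
by rewrite normf_div (ger0_norm V_ge0) ler_pdivrMr// lt0r V0 V_ge0.
Qed.

Lemma norm_MC_avg_le m : `|A m| <= B.
Proof.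
rewrite AE ratio_le// -(iintZ B (boxed_unit_ball R n)).
apply: (le_norm_iint (boxed_sample m) (boxedZ B (boxed_unit_ball R n))) => y _.
by rewrite normrM mulrC (ger0_norm (unit_ball_ge0 _ _)) ler_wpM2r// unit_ball_ge0.
Qed.

(* The coordinates [u_j] of the direction satisfy [<u_j^2> <= 1/N], whence
   [<|u_j|> <= 1/sqrt N], which compensates the factor [sqrt N] in the radius. *)
Lemma MC_avg_lipschitz (m m' : R) : `|A m - A m'| <=
  k%:R * (`|m - m'| + `|Num.sqrt (rho - m ^+ 2) - Num.sqrt (rho - m' ^+ 2)|).
Proof.
set s := _ - Num.sqrt _.
have N0 : 0 < Num.sqrt n.+1%:R :> R by rewrite sqrtr_gt0.
have rE : radius m - radius m' = Num.sqrt n.+1%:R * s.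
  by rewrite /radius !sqrtrM// -mulrBr.
pose q := Num.sqrt n.+1%:R : R.
have q2 : q ^+ 2 = n.+1%:R by rewrite sqr_sqrtr.
(* The majorant [G] comes from [q * |u| <= (1 + q ^+ 2 * u ^+ 2) / 2] with [q ^+ 2 = n.+1%:R]. After
   integration the quadratic term contributes at most [|s| / 2], which completes the half of [|s|]
   contained in [c]. *)
pose c : R := `|m - m'| + `|s| / 2.
pose G j y := c * unit_ball n.+1 y + `|s| * (n.+1%:R / 2) * direction_sqr (iota j) y.
pose M := `|c| * 1 + `| `|s| * (n.+1%:R / 2)| * 1 : R.
have bG j : boxed n M (G j).
  apply: boxedD; apply: boxedZ; first exact: boxed_unit_ball.
  exact: boxed_direction_sqr.
have [bS iS] := boxed_sum (index_enum 'I_k) bG.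
rewrite !AE -mulrBl; apply: ratio_le; first by rewrite mulr_ge0// addr_ge0.
rewrite -(iintB (boxed_sample m) (boxed_sample m')).
have bN := boxedZ (-1) (boxed_sample m').
have bD : boxed n (B + `|-1| * B)
    (fun y => unit_ball n.+1 y * f (sample m y) - unit_ball n.+1 y * f (sample m' y)).
  have := boxedD (boxed_sample m) bN; congr boxed.
  by apply/funext => y; rewrite mulN1r.
apply: le_trans (le_norm_iint bD bS _) _ => [y _|].
  rewrite -mulrBr normrM (ger0_norm (unit_ball_ge0 _ _)).
  have : `|f (sample m y) - f (sample m' y)| <=
      \sum_j (c + `|s| * (n.+1%:R / 2) * direction y (iota j) ^+ 2).
    apply: le_trans (lf _ _) _; apply: le_trans (sqrt_sum_sqr_le _) _.
    apply: ler_sum => j _; rewrite !mxE.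
    move: (direction y (iota j)) => u.
    rewrite (_ : _ - _ = (m - m') + (radius m - radius m') * u); last by ring.
    rewrite rE (le_trans (ler_normD _ _))// /c -addrA lerD2l !normrM.
    rewrite (gtr0_norm N0) -/q -q2.
    have -> : `|s| / 2 + `|s| * (q ^+ 2 / 2) * u ^+ 2 =
      `|s| * ((1 + q ^+ 2 * u ^+ 2) / 2) by field.
    rewrite [q * _]mulrC -mulrA ler_wpM2l//.
    have := sqr_ge0 (1 - q * `|u|).
    rewrite sqrrB expr1n mul1r exprMn real_normK ?num_real//. lra.
  move=> /(ler_wpM2l (unit_ball_ge0 n.+1 y)) /le_trans; apply.
  rewrite mulr_sumr; apply: ler_sum => j _; rewrite /G /direction_sqr.
  by rewrite le_eqVlt; apply/orP; left; apply/eqP; ring.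
rewrite iS.
apply: (@le_trans _ _ (\sum_(j < k) (`|m - m'| + `|s|) * V)); last first.
  by rewrite sumr_const card_ord -[leLHS]mulr_natl mulrA.
apply: ler_sum => j _; rewrite /G.
rewrite (iintD (boxedZ _ (boxed_unit_ball R n))
  (boxedZ _ (boxed_direction_sqr R (iota j)))).
rewrite (iintZ _ (boxed_unit_ball R n)) (iintZ _ (boxed_direction_sqr R (iota j))) -/V.
have := iint_direction_sqr_le R (iota j).
move=> /(ler_wpM2l (_ : 0 <= `|s| * (n.+1%:R / 2))) H.
apply: le_trans (lerD (lexx _) (H _)) _; first by rewrite mulr_ge0// divr_ge0.
rewrite -/V le_eqVlt; apply/orP; left; apply/eqP; rewrite /c; field.
by rewrite nat1r pnatr_eq0.
Qed.

End MicrocanonicalAverage.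

(** * The canonical weight *)

(** Writing the number of sites as [p.+3] turns the real exponent of the weight into a natural power
    of a square root. *)
Lemma powR_half_natB3 (R : realType) (a : R) (p : nat) : 0 <= a ->
  powR a ((p.+3%:R - 3) / 2) = Num.sqrt a ^+ p.
Proof.
move=> a0; by rewrite -addn3 natrD addrK mulrC powRrM powR12_sqrt// powR_mulrn//.
Qed.

Lemma is_derive1_ext (R : realType) (f g : R -> R) (x df dg : R) :
  is_derive x 1 f df -> f =1 g -> df = dg -> is_derive x 1 g dg.
Proof. by move=> ? /funext <- <-. Qed.

Lemma is_derive1M (R : realType) (f g : R -> R) (x df dg : R) :
  is_derive x 1 f df -> is_derive x 1 g dg ->
  is_derive x 1 (fun y => f y * g y) (f x * dg + g x * df).
Proof. by move=> f1 g1; apply: (is_derive1_ext (is_deriveM f1 g1)). Qed.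

Lemma is_derive1X (R : realType) (f : R -> R) n (x df : R) :
  is_derive x 1 f df ->
  is_derive x 1 (fun y => f y ^+ n.+1) (n.+1%:R * f x ^+ n * df).
Proof.
by move=> df1; apply: (is_derive1_ext (is_deriveX n.+1 df1)) => // y; rewrite exprfctE.
Qed.

Section Concentration.
Variables (R : realType) (rho m : R) (p : nat).
Hypothesis m2_lt : m ^+ 2 < rho.
Local Notation leb := (@lebesgue_measure R).

Let N : R := p.+3%:R.
Let mu := - (m / (rho - m ^+ 2)).
Let a := Num.sqrt rho.
Let D : set R := `]-a, a[.
Let sigma (x : R) := Num.sqrt (rho - x ^+ 2).
Let W (x : R) := expR (- (mu * N * x)) * sigma x ^+ p.
(** Two more powers of [sigma] than in [W]: they make [G] vanish at both endpoints even for [p = 0],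
    and leave a polynomial multiple of [W] after differentiation. *)
Let G (x : R) := (x - m) * (expR (- (mu * N * x)) * sigma x ^+ p.+2).
(* The derivative of [G] on [D]: the terms of order [N] combine to a multiple of
   [(x - m)^2] because [m] is the critical point of the weight. *)
Let G' (x : R) :=
  W x * (rho - m * x - N / (rho - m ^+ 2) * ((x - m) ^+ 2 * (rho + m * x))).

Let mD : measurable (D : set (measurableTypeR R)).
Proof. exact: measurable_itv. Qed.

Let rho_gt0 : 0 < rho.
Proof. exact: le_lt_trans (sqr_ge0 m) m2_lt. Qed.

Let a_gt0 : 0 < a.
Proof. by rewrite sqrtr_gt0. Qed.

Let aa : a ^+ 2 = rho.
Proof. by rewrite sqr_sqrtr// ltW. Qed.

Let delta_gt0 : 0 < rho - m ^+ 2.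
Proof. by rewrite subr_gt0. Qed.

Let continuous_sigma : continuous sigma.
Proof.
move=> x; rewrite /sigma.
apply: (@continuous_comp _ _ _ (fun x : R => rho - x ^+ 2) Num.sqrt).
  by apply: cvgB; [exact: cvg_cst|exact: exprn_continuous].
exact: sqrt_continuous.
Qed.

Let continuous_exp : continuous (fun x => expR (- (mu * N * x))).
Proof.
move=> x; apply: (@continuous_comp _ _ _ (fun x : R => - (mu * N * x)) expR).
  by apply: cvgN; apply: cvgM; [exact: cvg_cst|exact: cvg_id].
exact: continuous_expR.
Qed.

Let continuous_W : continuous W.
Proof.
move=> x; apply: cvgM; first exact: continuous_exp.
by apply: (@continuous_comp _ _ _ sigma (fun y => y ^+ p));
  [exact: continuous_sigma|exact: exprn_continuous].
Qed.

Let continuous_G : continuous G.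
Proof.
move=> x; apply: cvgM; first by apply: cvgB; [exact: cvg_id|exact: cvg_cst].
apply: cvgM; first exact: continuous_exp.
by apply: (@continuous_comp _ _ _ sigma (fun y => y ^+ p.+2));
  [exact: continuous_sigma|exact: exprn_continuous].
Qed.

Let continuous_G' : continuous G'.
Proof.
move=> x; apply: cvgM; first exact: continuous_W.
apply: cvgB.
  by apply: cvgB; [exact: cvg_cst|apply: cvgM; [exact: cvg_cst|exact: cvg_id]].
apply: cvgM; first exact: cvg_cst.
apply: cvgM; last first.
  by apply: cvgD; [exact: cvg_cst|apply: cvgM; [exact: cvg_cst|exact: cvg_id]].
apply: (@continuous_comp _ _ _ (fun x : R => x - m) (fun y => y ^+ 2)).
  by apply: cvgB; [exact: cvg_id|exact: cvg_cst].
exact: exprn_continuous.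
Qed.

Let sqr_lt x : D x -> x ^+ 2 < rho.
Proof.
rewrite /D /= in_itv/= -ltr_norml => xa.
by rewrite -aa -real_normK ?num_real// ltr_pXn2r// nnegrE// ltW.
Qed.

Let is_derive_G x : D x -> is_derive x 1 G (G' x).
Proof.
move=> Dx; have sx : 0 < rho - x ^+ 2 by rewrite subr_gt0 sqr_lt.
have s0 : 0 < sigma x by rewrite sqrtr_gt0.
have ds : is_derive x 1 sigma (- x / sigma x).
  have d1 : is_derive x 1 (fun y : R => rho - y ^+ 2) (- (2 * x)).
    apply: (is_derive1_ext (is_deriveB (is_derive_cst rho x 1)
      (is_deriveX 2 (is_derive_id x 1)))) => //=.
    by rewrite expr1 scaler1 sub0r.
  apply: (is_derive1_ext (@is_derive1_comp _ Num.sqrt (fun y => rho - y ^+ 2) x _ _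
    (is_derive1_sqrt sx) d1)) => //.
  by rewrite -/(sigma x); field; rewrite gt_eqF.
have de : is_derive x 1 (fun y => expR (- (mu * N * y)))
    (- (mu * N) * expR (- (mu * N * x))).
  have d1 : is_derive x 1 (fun y => - (mu * N * y)) (- (mu * N)).
    apply: (is_derive1_ext (is_deriveZ (- (mu * N)) (is_derive_id x 1))) => [y|].
      exact: mulNr.
    by rewrite scaler1.
  apply: (is_derive1_ext (@is_derive1_comp _ expR (fun y => - (mu * N * y)) x _ _
    (is_derive_expR _) d1)) => //.
  by rewrite mulrC.
have dm : is_derive x 1 (fun y => y - m) 1.
  apply: (is_derive1_ext (is_deriveB (is_derive_id x 1) (is_derive_cst m x 1))) => //.
  by rewrite subr0.
apply: (is_derive1_ext (is_derive1M dm (is_derive1M de (is_derive1X p.+1 ds)))) => //.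
(* Eliminating [rho] in this way encodes the square root relation, so that the remaining identity is
   one of rational functions. *)
have s2 : rho = sigma x ^+ 2 + x ^+ 2 by rewrite sqr_sqrtr ?subrK// ltW.
rewrite /G' /W !exprS.
have Ne : N = p.+2%:R + 1 by rewrite /N -natr1.
move: s2 s0; move: (sigma x) => s s2 s0.
move: (expR _) (s ^+ p) => e sp.
have := delta_gt0; rewrite /mu Ne s2; move: (p.+2%:R) => P d0.
by field; rewrite (gt_eqF d0) (gt_eqF s0).
Qed.

Let integrable_D (u : R -> R) : continuous u -> leb.-integrable D (EFin \o u).
Proof.
move=> cu; apply: (@integrableS _ _ _ leb `[- a, a]) => //.
  by move=> x; rewrite /D /= !in_itv/= => /andP[xa ax]; rewrite !ltW.
apply: continuous_compact_integrable; first exact: segment_compact.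
exact: continuous_subspaceT.
Qed.

(** [sigma] is not differentiable at the endpoints, but the fundamental theorem of calculus needs
    the derivative of [G] only inside, with [G] and [G'] continuous up to the boundary. *)
Let integral_G' : Rintegral leb D G' = 0.
Proof.
have ic : leb.-integrable `[- a, a] (EFin \o G').
  apply: continuous_compact_integrable; first exact: segment_compact.
  exact: continuous_subspaceT.
have Na : - a < a by rewrite gtrN.
have -> : Rintegral leb D G' = Rintegral leb `[- a, a] G'.
  rewrite Rintegral_itv_obnd_cbnd; last exact: integrable_D.
  rewrite Rintegral_itv_bndo_bndc//; apply: integrableS ic => //.
  by move=> x; rewrite /= !in_itv/= => /andP[-> ax]; rewrite ltW.
rewrite /Rintegral (continuous_FTC2 (F := G))//.
- by rewrite /G /sigma sqrrN aa subrr sqrtr0 expr0n !mulr0 -EFinB /= subrr.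
- exact: continuous_subspaceT.
- split=> [x xa||].
  + by case: (is_derive_G xa).
  + exact/cvg_at_right_filter/continuous_G.
  + exact/cvg_at_left_filter/continuous_G.
- move=> x xa; rewrite derive1E.
  by have ? := is_derive_G xa; exact: derive_val.
Qed.

Let W_ge0 x : 0 <= W x.
Proof. by rewrite mulr_ge0 ?expR_ge0// exprn_ge0// sqrtr_ge0. Qed.

Let integral_W_gt0 : 0 < Rintegral leb D W.
Proof.
(* A lower bound of [W] on []0, a / 2[], where [x ^+ 2 <= rho / 4]. *)
pose c := expR (- (`|mu * N| * a)) * Num.sqrt (rho / 2) ^+ p.
have c0 : 0 < c by rewrite mulr_gt0 ?expR_gt0// exprn_gt0// sqrtr_gt0 divr_gt0.
pose I : set R := `]0, a / 2[.
have ID : I `<=` D.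
  move=> x; rewrite /I /D /= !in_itv/= => /andP[x0 xa]; have a0 := a_gt0.
  by apply/andP; split; lra.
have i1 : leb.-integrable D (EFin \o (\1_I : R -> R)).
  by apply: integrableS (integrable_indic_itv _ _ _ _) => //.
apply: (@lt_le_trans _ _ (Rintegral leb D (fun x => c * \1_I x))).
  rewrite RintegralZl// mulr_gt0// /Rintegral integral_indic//; last first.
    exact: measurable_itv.
  rewrite (setIidl ID) /I /= lebesgue_measure_itv/= lte_fin divr_gt0//= subr0.
  by rewrite divr_gt0.
apply: le_Rintegral => //.
- have : leb.-integrable D (fun x => c%:E * (\1_I x)%:E)%E by exact: integrableZl.
  by apply: eq_integrable.
- exact: integrable_D.
move=> x Dx; rewrite indicE; case: (boolP (x \in I)) => [|_]; last by rewrite mulr0 W_ge0.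
rewrite inE /I /= in_itv/= mulr1 => /andP[x0 xa].
rewrite ler_pM ?expR_ge0 ?exprn_ge0 ?sqrtr_ge0//.
  rewrite ler_expR lerN2 (le_trans (ler_norm _))// normrM ler_wpM2l//.
  by rewrite gtr0_norm//; have := a_gt0; lra.
rewrite lerXn2r ?nnegrE ?sqrtr_ge0// ler_sqrt.
  have : x ^+ 2 <= (a / 2) ^+ 2 by rewrite ler_pXn2r ?nnegrE ?ltW// divr_gt0.
  by rewrite expr_div_n aa; have := rho_gt0; lra.
by rewrite subr_ge0 ltW ?sqr_lt.
Qed.

(** A lower bound of [rho + m * x] on [D], positive because [|m| < a]. *)
Let c0 := rho - `|m| * a.

Let c0_gt0 : 0 < c0.
Proof.
rewrite /c0 subr_gt0 -aa expr2 ltr_pM2r//.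
by rewrite -(@ltr_pXn2r _ 2)// ?nnegrE ?ltW// real_normK ?num_real// aa.
Qed.

Let D_norm_lt x : D x -> `|x| < a.
Proof. by rewrite /D /= in_itv/= -ltr_norml. Qed.

Let second_moment : Rintegral leb D (fun x => W x * (x - m) ^+ 2) <=
  2 * rho * (rho - m ^+ 2) / c0 / N * Rintegral leb D W.
Proof.
have N0 : 0 < N by rewrite ltr0n.
have cm : continuous (fun x => W x * (x - m) ^+ 2).
  move=> x; apply: cvgM; first exact: continuous_W.
  apply: (@continuous_comp _ _ _ (fun x : R => x - m) (fun y => y ^+ 2)).
    by apply: cvgB; [exact: cvg_id|exact: cvg_cst].
  exact: exprn_continuous.
pose C := N * c0 / (rho - m ^+ 2).
have C0 : 0 < C by rewrite divr_gt0// mulr_gt0.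
rewrite -(ler_pM2l C0) [leRHS](_ : _ = 2 * rho * Rintegral leb D W); last first.
  by rewrite /C; field; rewrite !gt_eqF.
(* Subtracting the vanishing integral of [G'] reduces the claim to a pointwise inequality, which
   follows from [c0 <= rho + m * x]. *)
rewrite -[leRHS]subr0 -integral_G' -!RintegralZl//; [|exact: integrable_D..].
have cW : continuous (fun x => 2 * rho * W x).
  by move=> x; apply: cvgM; [exact: cvg_cst|exact: continuous_W].
rewrite -RintegralB//; [|exact: integrable_D..].
apply: le_Rintegral => //.
- by apply: integrable_D => x; apply: cvgM; [exact: cvg_cst|exact: cm].
- apply: integrable_D => x; apply: cvgB; [exact: cW|exact: continuous_G'].
move=> x Dx; rewrite /G' mulrCA [2 * rho * _]mulrC -mulrBr ler_wpM2l//.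
have xa := D_norm_lt Dx.
have mx : `|m * x| <= `|m| * a by rewrite normrM ler_wpM2l// ltW.
have ma : `|m| * a <= rho by have := c0_gt0; rewrite /c0; lra.
move: mx; rewrite ler_norml => /andP[mx1 mx2].
have H : C * (x - m) ^+ 2 <= N / (rho - m ^+ 2) * ((x - m) ^+ 2 * (rho + m * x)).
  rewrite /C (mulrAC N c0) -[leLHS]mulrA.
  apply: ler_wpM2l; first by rewrite divr_ge0// ltW.
  rewrite [leLHS]mulrC ler_wpM2l ?sqr_ge0// /c0; lra.
lra.
Qed.

Let sqrtN_gt0 : 0 < Num.sqrt N.
Proof. by rewrite sqrtr_gt0 ltr0n. Qed.

Lemma canonical_concentration (A : R -> R) (B L : R) :
  measurable_fun setT A -> (forall x, `|A x| <= B) -> 0 <= L ->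
  (forall x, D x -> `|A x - A m| <= L * `|x - m|) ->
  `|Rintegral leb D (fun x => expR (- (mu * N * x)) *
        powR (rho - x ^+ 2) ((N - 3) / 2) * A x) /
    Rintegral leb D (fun x => expR (- (mu * N * x)) *
        powR (rho - x ^+ 2) ((N - 3) / 2)) - A m| <=
  L * (1 + 2 * rho * (rho - m ^+ 2) / (rho - `|m| * Num.sqrt rho)) / 2 / Num.sqrt N.
Proof.
move=> mA AB L0 AL.
have WE x : D x -> expR (- (mu * N * x)) * powR (rho - x ^+ 2) ((N - 3) / 2) = W x.
  by move=> Dx; rewrite powR_half_natB3// subr_ge0 ltW ?sqr_lt.
rewrite (@eq_Rintegral _ _ _ leb D (fun x => W x * A x)); last first.
  by move=> x /set_mem Dx; rewrite WE.
rewrite [X in _ / X](@eq_Rintegral _ _ _ leb D W); last first.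
  by move=> x /set_mem Dx; rewrite WE.
set Z := Rintegral leb D W; have Z0 : 0 < Z := integral_W_gt0.
have mW : measurable_fun D W.
  by apply: measurable_funTS; exact: continuous_measurable_fun.
have iWA : leb.-integrable D (EFin \o (fun x => W x * A x)).
  have iBW : leb.-integrable D (EFin \o (fun x => B * W x)).
    by apply: integrable_D => x; apply: cvgM; [exact: cvg_cst|exact: continuous_W].
  apply: (le_integrable _ _ _ iBW) => //.
    by apply/measurable_EFinP; apply: measurable_funM => //; exact: measurable_funTS.
  move=> x _ /=; rewrite lee_fin !normrM mulrC ler_wpM2r//.
  exact: le_trans (AB x) (ler_norm B).
have iW := integrable_D continuous_W.
have iWm : leb.-integrable D (EFin \o (fun x => A m * W x)).
  by apply: integrable_D => x; apply: cvgM; [exact: cvg_cst|exact: continuous_W].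
have iD : leb.-integrable D (EFin \o (fun x => W x * A x - A m * W x)).
  by have := integrableB mD iWA iWm; apply: eq_integrable.
have -> : Rintegral leb D (fun x => W x * A x) / Z - A m =
    Rintegral leb D (fun x => W x * A x - A m * W x) / Z.
  rewrite RintegralB// (RintegralZl _ mD iW) -/Z; field; exact: lt0r_neq0.
rewrite normf_div (gtr0_norm Z0) ler_pdivrMr//.
apply: le_trans (le_normr_Rintegral mD iD) _.
pose q := Num.sqrt N; have q0 : 0 < q := sqrtN_gt0.
have q2 : q ^+ 2 = N by rewrite sqr_sqrtr// ler0n.
pose V x := W x * (x - m) ^+ 2.
have cV : continuous V.
  move=> x; apply: cvgM; first exact: continuous_W.
  apply: (@continuous_comp _ _ _ (fun x : R => x - m) (fun y => y ^+ 2)).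
    by apply: cvgB; [exact: cvg_id|exact: cvg_cst].
  exact: exprn_continuous.
have cqW : continuous (fun x => L / 2 / q * W x).
  by move=> x; apply: cvgM; [exact: cvg_cst|exact: continuous_W].
have cqV : continuous (fun x => L / 2 * q * V x).
  by move=> x; apply: cvgM; [exact: cvg_cst|exact: cV].
(* In place of Cauchy-Schwarz, [|x - m| <= (q^-1 + q * (x - m) ^+ 2) / 2] with [q = Num.sqrt N]
   bounds the first moment by the second; both terms are then of order [q^-1]. *)
apply: (@le_trans _ _ (Rintegral leb D (fun x => L / 2 / q * W x + L / 2 * q * V x))).
  apply: le_Rintegral => //.
  - exact: (integrable_norm iD).
  - by apply: integrable_D => x; apply: cvgD; [exact: cqW|exact: cqV].
  move=> x Dx; rewrite (mulrC (A m)) -mulrBr normrM ger0_norm ?W_ge0//.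
  rewrite (_ : _ + _ = W x * (L * ((q^-1 + q * (x - m) ^+ 2) / 2))); last first.
    by rewrite /V; ring.
  rewrite ler_wpM2l// (le_trans (AL x Dx))// ler_wpM2l//.
  have := sqr_ge0 (1 - q * `|x - m|).
  rewrite sqrrB expr1n mul1r exprMn real_normK ?num_real// => H.
  rewrite -(ler_pM2l q0) [leRHS](_ : _ = (1 + q ^+ 2 * (x - m) ^+ 2) / 2); first by lra.
  by field; exact: lt0r_neq0.
rewrite RintegralD//; [|exact: integrable_D..].
rewrite !RintegralZl//; [|exact: integrable_D..].
have := second_moment; rewrite -/Z => /(ler_wpM2l (_ : 0 <= L / 2 * q)) H.
apply: le_trans (lerD (lexx _) (H _)) _; first by rewrite mulr_ge0 ?divr_ge0// ltW.
rewrite le_eqVlt; apply/orP; left; apply/eqP.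
by rewrite -/c0 -/q -q2; field; rewrite !lt0r_neq0.
Qed.

End Concentration.

(** * Comparison of the ensembles *)

(** Multiplying the difference by the sum of the two roots gives a difference of squares. That sum
    is at least [Num.sqrt (rho - y ^+ 2)], so the constant stays finite when [x] approaches the
    endpoints. *)
Lemma sqrt_sub_sqr_lipschitz (R : realType) (rho x y : R) :
  `|x| <= Num.sqrt rho -> y ^+ 2 < rho ->
  `|Num.sqrt (rho - x ^+ 2) - Num.sqrt (rho - y ^+ 2)| <=
    2 * Num.sqrt rho / Num.sqrt (rho - y ^+ 2) * `|x - y|.
Proof.
move=> xa y2; have rho0 : 0 < rho := le_lt_trans (sqr_ge0 y) y2.
have ya : `|y| <= Num.sqrt rho.
  rewrite -(@ler_pXn2r _ 2)// ?nnegrE ?sqrtr_ge0// real_normK ?num_real//.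
  by rewrite sqr_sqrtr ltW.
have x2 : x ^+ 2 <= rho.
  rewrite -(sqr_sqrtr (ltW rho0)) -real_normK ?num_real//.
  by rewrite ler_pXn2r// nnegrE sqrtr_ge0.
set s := Num.sqrt (rho - x ^+ 2); set t := Num.sqrt (rho - y ^+ 2).
have t0 : 0 < t by rewrite sqrtr_gt0 subr_gt0.
have s0 : 0 <= s := sqrtr_ge0 _.
rewrite mulrAC ler_pdivlMr//.
apply: (@le_trans _ _ (`|s - t| * (s + t))); first by rewrite ler_wpM2l// lerDr.
rewrite -[in leLHS](ger0_norm (addr_ge0 s0 (ltW t0))) -normrM -subr_sqr.
rewrite !sqr_sqrtr ?subr_ge0 ?(ltW y2)//.
rewrite (_ : _ - _ = - ((x - y) * (x + y))); last by ring.
rewrite normrN normrM mulrC ler_wpM2r// (le_trans (ler_normD _ _))//.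
by rewrite mulr2n mulrDl !mul1r lerD.
Qed.

Lemma sqrt_ratio_pow_le (R : realType) (a b : R) : 0 < b -> b < a ->
  exists C : R, forall p : nat,
    Num.sqrt b ^+ p / Num.sqrt a ^+ p <= C / Num.sqrt p.+3%:R.
Proof.
move=> b0 ba; have a0 := lt_trans b0 ba.
pose t := a / b - 1; have t0 : 0 < t by rewrite subr_gt0 ltr_pdivlMr// mul1r.
(* With [a / b = 1 + t], Bernoulli gives [(1 + t) ^+ p >= 1 + p%:R * t], and
   [(1 + p%:R * t) * (3 + t^-1)] is at least [p.+3%:R]. *)
exists (Num.sqrt (3 + t^-1)) => p.
have C0 : 0 <= 3 + t^-1 by rewrite addr_ge0// invr_ge0 ltW.
rewrite -(@ler_pXn2r _ 2)// ?nnegrE ?divr_ge0 ?exprn_ge0 ?sqrtr_ge0//.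
have sqrE (x : R) : 0 <= x -> (Num.sqrt x ^+ p) ^+ 2 = x ^+ p.
  by move=> x0; rewrite -exprM mulnC exprM sqr_sqrtr.
rewrite !expr_div_n (sqrE _ (ltW b0)) (sqrE _ (ltW a0)) (sqr_sqrtr C0) sqr_sqrtr ?ler0n//.
rewrite ler_pdivlMr ?ltr0n// mulrAC ler_pdivrMr ?exprn_gt0//.
have -> : a = b * (1 + t) by rewrite /t; field; exact: lt0r_neq0.
rewrite exprMn mulrCA; apply: ler_wpM2l; first by rewrite exprn_ge0// ltW.
have bern : 1 + p%:R * t <= (1 + t) ^+ p.
  elim: p {sqrE} => [|p IH]; first by rewrite mul0r addr0 expr0.
  rewrite exprS -natr1; apply: (@le_trans _ _ ((1 + t) * (1 + p%:R * t))).
    have : 0 <= p%:R * t * t by rewrite !mulr_ge0// ltW.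
    by move=> H; rewrite -subr_ge0 (_ : _ - _ = p%:R * t * t)//; ring.
  by rewrite ler_wpM2l// addr_ge0// ltW.
rewrite [leRHS]mulrC; apply: le_trans (ler_wpM2r C0 bern).
have -> : (1 + p%:R * t) * (3 + t^-1) = p.+3%:R + t^-1 + p%:R * t * 3.
  by rewrite -addn3 natrD; field; exact: lt0r_neq0.
by rewrite -addrA lerDl !addr_ge0 ?mulr_ge0 ?invr_ge0 ?(ltW t0).
Qed.

Lemma weighted_mean_dist (R : realType) (z w u v B : R) : 0 < z -> 0 <= w ->
  `|u| <= B -> `|v| <= B ->
  `|z / (z + w) * u + w / (z + w) * v - u| <= 2 * B * (w / z).
Proof.
move=> z0 w0 uB vB; have zw : 0 < z + w by rewrite ltr_wpDr.
have -> : z / (z + w) * u + w / (z + w) * v - u = (v - u) * (w / (z + w)).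
  by field; exact: lt0r_neq0.
rewrite normrM (ger0_norm (divr_ge0 w0 (ltW zw))).
apply: ler_pM => //; first by rewrite divr_ge0// ltW.
  by rewrite (le_trans (ler_normB _ _))// mulr2n mulrDl !mul1r lerD.
by rewrite ler_wpM2l// lef_pV2 ?posrE// lerDl.
Qed.

(** * Reduction of the fixed energy ensemble to a single magnetization *)

Section FixedEnergy.
Variables (R : realType) (J h rho eps : R).
Hypotheses (J0 : 0 < J) (h0 : h != 0) (E : in_energy_set J h rho eps).

Let s := Num.sqrt (h ^+ 2 / J ^+ 2 - 2 * eps / J).
Let m := - (h / J) + Num.sg h * s.
Let m' := - (h / J) - Num.sg h * s.

Let radicandE : h ^+ 2 / J ^+ 2 - 2 * eps / J = 2 / J * (h ^+ 2 / (2 * J) - eps).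
Proof. by field; exact: lt0r_neq0. Qed.

Let m_cases : (m = m_plus J h eps /\ m' = m_minus J h eps) \/
  (m = m_minus J h eps /\ m' = m_plus J h eps).
Proof.
rewrite /m /m' /m_plus /m_minus -/s.
have [hp|hn] : 0 < h \/ h < 0 by have [?|?|hz] := ltgtP h 0; [right|left|
    by move: h0; rewrite hz eqxx].
  by left; rewrite gtr0_sg// mul1r.
by right; rewrite ltr0_sg// mulN1r opprK.
Qed.

(** Nonnegativity of the right-hand side identifies [m] as the root of smaller absolute value,
    strictly so when [s > 0]. *)
Let sqr_m'B : m' ^+ 2 - m ^+ 2 = 4 * (`|h| / J) * s.
Proof. by rewrite /m /m' normrEsg; field; exact: lt0r_neq0. Qed.

(** Pulling out the sign of [h] gives [m = - Num.sg h * (|h| / J - s)], so the energy condition is a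
    bound on [|m|]. *)
Lemma sqr_magnetization_lt : m ^+ 2 < rho.
Proof.
have [_] := E; rewrite -/s => Em.
have r0 : 0 < rho.
  by rewrite -sqrtr_gt0; exact: le_lt_trans (normr_ge0 _) Em.
have -> : m ^+ 2 = `| `|h| / J - s| ^+ 2.
  rewrite real_normK ?num_real// /m -{1}[h]mulr_sg_norm.
  rewrite (_ : _ + _ = - Num.sg h * (`|h| / J - s)); last by ring.
  by rewrite exprMn sqrrN sqr_sg h0 mul1r.
by rewrite -[ltRHS](sqr_sqrtr (ltW r0)) ltr_pXn2r// nnegrE// sqrtr_ge0.
Qed.

Lemma FE_avg_close (B : R) : exists C : R, forall (p : nat) (g : ('I_p.+3 -> R) -> R),
  (forall x, `|MC_avg x rho g| <= B) ->
  `|FE_avg J h eps rho g - MC_avg m rho g| <= C / Num.sqrt p.+3%:R.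
Proof.
have m2 := sqr_magnetization_lt.
have B_ge0 p (g : ('I_p.+3 -> R) -> R) : (forall x, `|MC_avg x rho g| <= B) -> 0 <= B.
  by move=> /(_ 0); exact: le_trans.
have [Eeps _] := E.
(* At the maximal energy [s = 0], both roots coincide with [- (h / J)], and the two averages are
   equal. *)
have [lt_eps|] := boolP (eps < h ^+ 2 / (2 * J)); last first.
  rewrite -leNgt => le_eps.
  have eq_eps : eps = h ^+ 2 / (2 * J) by apply/eqP; rewrite eq_le Eeps le_eps.
  have mE : m = - (h / J).
    by rewrite /m /s radicandE eq_eps subrr mulr0 sqrtr0 mulr0 addr0.
  exists 0 => p g _; rewrite /FE_avg eq_eps !ltxx /= eqxx /=.
  move: m2; rewrite mE sqrrN expr_div_n => ->.
  by rewrite subrr normr0 mul0r.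
have s0 : 0 < s.
  by rewrite sqrtr_gt0 radicandE mulr_gt0 ?divr_gt0// subr_gt0.
have mm' : m ^+ 2 < m' ^+ 2.
  by rewrite -subr_gt0 sqr_m'B !mulr_gt0// ?invr_gt0// normr_gt0.
(* If [m'] is not admissible, the ensemble is by definition the average at the smaller root [m], and
   the difference is again zero. *)
have [m'2|m'2] := ltP (m' ^+ 2) rho; last first.
  exists 0 => p g _; rewrite /FE_avg lt_eps /=.
  have am : `|m| < `|m'| by rewrite -(@ltr_pXn2r _ 2)// ?nnegrE// !real_normK ?num_real.
  case: m_cases => -[<- <-].
    rewrite m2 ltNge m'2 /= gt_min m2 /= le_max m'2 orbT (ltW am).
    by rewrite subrr normr0 mul0r.
  rewrite m2 ltNge m'2 /= gt_min m2 orbT /= le_max m'2 /= (leNgt `|m'|) am /=.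
  by rewrite subrr normr0 mul0r.
have [||C HC] := @sqrt_ratio_pow_le R (rho - m ^+ 2) (rho - m' ^+ 2).
- by rewrite subr_gt0.
- by rewrite ltrD2l ltrN2.
exists (2 * B * C) => p g gB.
have Z0 (x : R) : x ^+ 2 < rho -> 0 < Z_MC x rho p.+3.
  by move=> x2; rewrite powR_gt0// subr_gt0.
have Zr : Z_MC m' rho p.+3 / Z_MC m rho p.+3 <= C / Num.sqrt p.+3%:R.
  by rewrite /Z_MC !powR_half_natB3 ?subr_ge0 ?(ltW m2) ?(ltW m'2).
have W : `|Z_MC m rho p.+3 / (Z_MC m rho p.+3 + Z_MC m' rho p.+3) * MC_avg m rho g +
    Z_MC m' rho p.+3 / (Z_MC m rho p.+3 + Z_MC m' rho p.+3) * MC_avg m' rho g -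
    MC_avg m rho g| <= 2 * B * C / Num.sqrt p.+3%:R.
  apply: le_trans (weighted_mean_dist (Z0 _ m2) (ltW (Z0 _ m'2)) (gB m) (gB m')) _.
  by rewrite -[leRHS]mulrA ler_wpM2l// mulr_ge0// (B_ge0 _ g).
(* The mixture is symmetric in its two roots, so for [m = m_minus] it only remains to reorder the
   sums. *)
rewrite /FE_avg lt_eps; case: m_cases => -[<- <-]; rewrite m2 m'2 !andbT.
  exact: W.
rewrite (addrC (Z_MC m' _ _)).
rewrite (addrC (_ * MC_avg m' _ _)).
exact: W.
Qed.

End FixedEnergy.

Local Close Scope classical_set_scope.

Theorem theorem4p26 (R : realType) (J h rho eps : R) (k : nat)
    (f : 'rV[R]_k -> R) :
  0 < J -> h != 0 -> 0 < rho -> in_energy_set J h rho eps ->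
  bounded_fun f -> lipschitz1_2 f ->
  let m := - (h / J) + Num.sg h * Num.sqrt (h ^+ 2 / J ^+ 2 - 2 * eps / J) in
  let mu := - (m / (rho - m ^+ 2)) in
  exists (C : R) (N0 : nat), forall (N : nat) (iota : 'I_k -> 'I_N),
    (N0 <= N)%N -> injective iota ->
    `| FE_avg J h eps rho (fun phi => f (proj_I iota phi))
       - C_avg mu rho (fun phi => f (proj_I iota phi)) |
      <= C / Num.sqrt N%:R.
Proof.
move=> J0 h0 rho0 E bf lf m mu.
have m2 : m ^+ 2 < rho := sqr_magnetization_lt h0 E.
have [B fB] : exists B : R, forall x, `|f x| <= B.
  (* [bounded_fun] provides a bound by every number strictly above [M], hence [M + 1]. *)
  have [M [_ HM]] := bf; exists (M + 1) => x.
  by apply: HM => //; rewrite ltrDl.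
have [C1 HC1] := FE_avg_close J0 h0 E B.
(* The Lipschitz constant at [m]: [MC_avg_lipschitz] with its square root term estimated by
   [sqrt_sub_sqr_lipschitz]. *)
pose L : R := k%:R * (1 + 2 * Num.sqrt rho / Num.sqrt (rho - m ^+ 2)).
have L0 : 0 <= L by rewrite !(mulr_ge0, addr_ge0, invr_ge0, sqrtr_ge0).
pose C2 : R := L * (1 + 2 * rho * (rho - m ^+ 2) / (rho - `|m| * Num.sqrt rho)) / 2.
(* From three sites on, [N] has the form [p.+3] and the exponent of the weight is nonnegative. *)
exists (C1 + C2), 3%N => N iota N3 _.
case: N N3 iota => [|[|[|p]]] // _ iota.
set g := fun phi => f (proj_I iota phi).
have FE := HC1 p g (norm_MC_avg_le lf fB rho iota).
have CA : `|C_avg mu rho g - MC_avg m rho g| <= C2 / Num.sqrt p.+3%:R.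
  have AL (x : R) : `]- Num.sqrt rho, Num.sqrt rho[%classic x ->
      `|MC_avg x rho g - MC_avg m rho g| <= L * `|x - m|.
    rewrite /= in_itv/= -ltr_norml => /ltW xa.
    apply: le_trans (MC_avg_lipschitz lf fB rho iota x m) _.
    rewrite /L -[leRHS]mulrA ler_wpM2l// mulrDl mul1r lerD2l.
    exact: sqrt_sub_sqr_lipschitz.
  exact: (canonical_concentration p m2 (measurable_MC_avg lf rho iota)
    (norm_MC_avg_le lf fB rho iota) L0 AL).
rewrite mulrDl -[X in `|X|](subrKA (MC_avg m rho g)).
by rewrite (le_trans (ler_normD _ _))// lerD// distrC.
Qed.
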